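(* Let $\kappa$ be an infinite cardinal and $\lambda\ge\kappa$. Then ${}^{<\kappa}\square\,2^\lambda$ is b-ultraparacompact if and only if for every dense $S\subseteq\mathrm{Fn}(\lambda,\kappa,2)$ there is $R\subseteq\mathrm{Fn}(\lambda,\kappa,2)$ with $S\le R$ such that $R$ is an antichain in $\mathrm{Fn}(\lambda,\kappa,2)$ and $R$ is dense.
   Context: $2=\{0,1\}$ is discrete. $\mathrm{Fn}(\lambda,\kappa,2)$ is the set of partial functions $s$ from $\lambda$ to $2$ with $|\mathrm{dom}(s)|<\kappa$, ordered by inclusion; an antichain is a set of pairwise incompatible such functions (no two have a common extension, i.e. they disagree at some common point of their domains). $S\subseteq\mathrm{Fn}(\lambda,\kappa,2)$ is dense if for every $f:\lambda\to2$ there is $s\in S$ with $s\subseteq f$. For $R,S\subseteq\mathrm{Fn}(\lambda,\kappa,2)$, $S\le R$ means that for every $r\in R$ there is $s\in S$ with $s\subseteq r$. ${}^{<\kappa}\square\,2^\lambda$ is the set of functions $\lambda\to2$ with canonical base the clopen sets $[s]=\{f:s\subseteq f\}$, $s\in\mathrm{Fn}(\lambda,\kappa,2)$; it is b-ultraparacompact if every open cover has a refinement (a cover each of whose members lies in a member of the given cover) consisting of pairwise disjoint sets from this canonical base. *)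

(* Defs.v *)
From HB Require Import structures.
From mathcomp Require Import all_boot.
From mathcomp Require Import boolp classical_sets functions cardinality.
From mathcomp Require Import filter topology_structure.

Set Implicit Arguments.
Unset Strict Implicit.
Unset Printing Implicit Defensive.

Local Open Scope classical_set_scope.
Local Open Scope card_scope.

(* Cardinals are represented by types: [K] stands for kappa = |K| and [L] for
   lambda = |L|, used as the index set.  Every notion below depends on [K] and
   [L] only through their cardinalities. *)

Definition card_lt T U (A : set T) (B : set U) := A #<= B /\ A #!= B.

Section CardinalArithmetic.

Lemma card_injP T (U : pointedType) (A : set T) (B : set U) :
  A #<= B <-> exists2 f : T -> U, set_fun A B f & set_inj A f.
Proof. by rewrite -injfunPex; split=> [/pcard_leP|/pcard_leP]. Qed.

Lemma card_le_total T U (A : set T) (B : set U) : A #<= B \/ B #<= A.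
Proof.
elim/Ppointed: T => T in A *; first by left; rewrite !emptyE.
elim/Ppointed: U => U in B *; first by right; rewrite !emptyE.
pose P := [set G : set (T * U) | [/\ G `<=` A `*` B,
  forall x y y', G (x, y) -> G (x, y') -> y = y' &
  forall x x' y, G (x, y) -> G (x', y) -> x = x']].
have [|G [[GAB Gf Gi] Gmax]] := @Zorn_bigcup _ P.
  move=> F FP Ftot; split.
  - by apply: bigcup_sub => X /FP[].
  - move=> x y y' [X FX Xy] [Y FY Yy].
    have [XY|YX] := Ftot _ _ FX FY.
    + by have [_ + _] := FP _ FY; apply; [exact: XY Xy|exact: Yy].
    + by have [_ + _] := FP _ FX; apply; [exact: Xy|exact: YX Yy].
  - move=> x y y' [X FX Xy] [Y FY Yy].
    have [XY|YX] := Ftot _ _ FX FY.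
    + by have [_ _ +] := FP _ FY; apply; [exact: XY Xy|exact: Yy].
    + by have [_ _ +] := FP _ FX; apply; [exact: Xy|exact: YX Yy].
have [domG|] := pselect (forall x, A x -> exists y, G (x, y)).
  left; apply/card_injP; exists (fun x => get [set y | G (x, y)]).
    by move=> x /domG /getPex /GAB[].
  move=> x x' /set_mem /domG /getPex /= Gx /set_mem /domG /getPex /= Gx' e.
  by apply: Gi Gx _; rewrite e.
move=> /existsNP[x /not_implyP[Ax nGx]].
have [ranG|] := pselect (forall y, B y -> exists x, G (x, y)).
  right; apply/card_injP; exists (fun y => get [set x | G (x, y)]).
    by move=> y /ranG /getPex /GAB[].
  move=> y y' /set_mem /ranG /getPex /= Gx /set_mem /ranG /getPex /= Gx' e.
  by apply: Gf Gx _; rewrite e.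
move=> /existsNP[y /not_implyP[By nGy]].
exfalso; apply: (Gmax (G `|` [set (x, y)])).
  split; first by move=> ? ?; left.
  by move=> /(_ (x, y) (or_intror erefl)) Gxy; apply: nGx; exists y.
split.
- by move=> z [/GAB//|->].
- move=> u v v' [Guv|[-> ->]] [Guv'|[]]; [exact: Gf Guv Guv'| | |by move=> ->].
  + by move=> ux _; case: nGx; exists v; rewrite -ux.
  + by case: nGx; exists v'.
- move=> u u' v [Guv|[-> ->]] [Guv'|[]]; [exact: Gi Guv Guv'| | |by move=> ->].
  + by move=> _ vy; case: nGy; exists u; rewrite -vy.
  + by case: nGy; exists u'.
Qed.

Lemma infinite_setX_bool T (A : set T) : infinite_set A ->
  A `*` [set: bool] #<= A.
Proof.
elim/Ppointed: T => T in A *.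
  by move=> Ainf; exfalso; apply: Ainf; rewrite emptyE; exact: finite_set0.
move=> Ainf.
pose D := [set e : set T | e `<=` A /\ e #= [set: nat]].
have exD (X : set T) : X `<=` A -> infinite_set X ->
    exists2 e, D e & e `<=` X.
  move=> XA /infiniteP /card_injP[f fX finj]; exists (range f).
    split; first by move=> _ [n _ <-]; exact/XA/fX.
    apply: eq_card_nat; first exact: (card_image_le f [set: nat]).
    by apply/infiniteP/card_injP; exists f => // n _; exists n.
  by move=> _ [n _ <-]; exact: fX.
have [E [ED tE Emax]] := ex_maximal_disjoint_subcollection id D.
have Dn0 e : D e -> e !=set0.
  move=> [_ /card_eqPle[_ h]]; apply/set0P; apply: contraPneq h => ->.
  rewrite card_le0 => /eqP/(congr1 (@^~ 0%N)); rewrite propeqE => -[h _].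
  exact: h.
pose L := A `\` \bigcup_(e in E) e.
have Lfin : finite_set L.
  apply: contrapT => /exD[|e De eL]; first by move=> x [].
  have disj e' : E e' -> ~ (e `&` e' !=set0).
    by move=> Ee' [x [/eL[_ h] e'x]]; apply: h; exists e'.
  apply: (Emax (E `|` [set e])).
  - split; first by move=> ? ?; left.
    move=> /(_ e (or_intror erefl)) /disj; apply.
    by have [x ex] := Dn0 _ De; exists x.
  - by move=> e' [/ED//|->].
  - move=> e1 e2 [E1|->] [E2|->] //=.
    + exact: tE.
    + by rewrite setIC => /disj.
    + by move=> /disj.
have [e0 Ee0] : E !=set0.
  apply/set0P/negP => /eqP E0; apply: Ainf; move: Lfin.
  by rewrite /L E0 bigcup_set0 setD0.
pose c x := get [set e | E e /\ (e x \/ ~ (\bigcup_(e in E) e) x /\ e = e0)].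
have cP x : E (c x) /\ (c x x \/ ~ (\bigcup_(e in E) e) x /\ c x = e0).
  suff /getPex : exists e, E e /\ (e x \/ ~ (\bigcup_(e in E) e) x /\ e = e0).
    by [].
  have [[e Ee ex]|nx] := pselect ((\bigcup_(e in E) e) x).
    by exists e; split => //; left.
  by exists e0; split => //; right.
pose fib e := [set x | A x /\ c x = e].
have fibE e : E e -> fib e #= [set: nat].
  move=> Ee; have [eA enat] := ED _ Ee.
  have efib : e `<=` fib e.
    move=> x ex; split; first exact: eA.
    have [Ec [cx|[nx _]]] := cP x; last by case: nx; exists e.
    by apply: tE => //; exists x.
  apply: eq_card_nat.
    apply: (@sub_countable _ _ _ (e `|` L)).
      apply: subset_card_le => x [Ax cx].
      have [_ [|[nx _]]] := cP x; first by rewrite cx; left.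
      by right.
    have -> : e `|` L = \bigcup_(b in [set: bool]) if b then e else L.
      rewrite predeqE => x; split; first by case; [exists true|exists false].
      by move=> [[] _]; [left|right].
    apply: bigcup_countable => // -[] _; last exact: finite_set_countable.
    by rewrite (eq_countable enat).
  apply: sub_infinite_set efib _.
  by rewrite (eq_finite_set enat); exact: infinite_nat.
have hP e : E e -> exists2 h : T * bool -> T,
    set_fun (fib e `*` [set: bool]) (fib e) h & set_inj (fib e `*` [set: bool]) h.
  move=> /fibE fe; apply/card_injP; rewrite (card_le_eqr fe).
  by apply: countableX => //; rewrite (eq_countable fe).
have [h hf] : exists h : set T -> T * bool -> T, forall e, E e ->
    set_fun (fib e `*` [set: bool]) (fib e) (h e) /\
    set_inj (fib e `*` [set: bool]) (h e).
  have /choice[h hh] : forall e, exists h : T * bool -> T, E e ->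
      set_fun (fib e `*` [set: bool]) (fib e) h /\
      set_inj (fib e `*` [set: bool]) h.
    move=> e; have [/hP[h h1 h2]|] := pselect (E e); first by exists h.
    by move=> nE; exists fst.
  by exists h.
apply/card_injP; exists (fun z => h (c z.1) z).
  move=> z [Az _]; have [+ _] := cP z.1 => /hf[/(_ z) + _].
  by case.
move=> z z' /set_mem[Az _] /set_mem[Az' _] /= e.
have [Ez _] := cP z.1; have [hz hi] := hf _ Ez.
have [Ez' _] := cP z'.1; have [hz' _] := hf _ Ez'.
have [_ c1] : fib (c z.1) (h (c z.1) z) by apply: hz.
have [_ c2] : fib (c z'.1) (h (c z'.1) z') by apply: hz'.
have cc : c z.1 = c z'.1 by rewrite -c1 e c2.
by apply: hi; rewrite ?inE //= ?cc// -?cc//; rewrite -cc in e.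
Qed.

Lemma card_setU_le T U (A B : set T) (C : set U) : infinite_set C ->
  A #<= C -> B #<= C -> A `|` B #<= C.
Proof.
move=> Cinf; have := infinite_setX_bool Cinf.
elim/Ppointed: U => U in C Cinf *.
  by exfalso; apply: Cinf; rewrite emptyE.
move=> CC /card_injP[f fC fi] /card_injP[g gC gi].
apply: card_le_trans CC; apply/card_injP.
exists (fun x => if x \in A then (f x, true) else (g x, false)).
  move=> x ABx; case: ifPn => [/set_mem Ax|/negP nA]; split => //=.
    exact: fC.
  by apply: gC; case: ABx => // Ax; case: nA; rewrite inE.
move=> x y /set_mem ABx /set_mem ABy.
case: ifPn => [Ax|/negP nx]; case: ifPn => [Ay|/negP ny] // [].
  exact: fi.
have Bx : B x by case: ABx => // Ax; case: nx; rewrite inE.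
have By : B y by case: ABy => // Ay; case: ny; rewrite inE.
by apply: gi; rewrite inE.
Qed.

Lemma card_lt_setU T U (A B : set T) (C : set U) : infinite_set C ->
  card_lt A C -> card_lt B C -> card_lt (A `|` B) C.
Proof.
move=> Cinf [AC nAC] [BC nBC]; split; first exact: card_setU_le.
have nle (X : set T) : X #<= C -> X #!= C -> ~ (C #<= X).
  by move=> XC /negP nXC CX; apply: nXC; rewrite card_eq_le XC.
apply/negP => /card_eqPle[_ CAB].
wlog BA : A B AC BC nAC nBC CAB / B #<= A.
  move=> W; have [AB|] := card_le_total A B; last exact: W.
  by apply: (W B A) => //; rewrite setUC.
have [Afin|Ainf] := pselect (finite_set A).
  apply: Cinf; apply: card_le_finite CAB _; rewrite finite_setU; split => //.
  exact: card_le_finite BA Afin.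
apply: nle AC nAC _; apply: card_le_trans CAB _; exact: card_setU_le.
Qed.

End CardinalArithmetic.

Section PartialFunctions.
Variables K L : Type.
Implicit Types (s r t : L -> option bool) (f : L -> bool).

(* A partial function from [L] to 2 is a map [L -> option bool], undefined at
   the points sent to [None]. *)
Definition pdom s : set L := [set x | s x <> None].

Definition pfun_sub s t := forall x b, s x = Some b -> t x = Some b.

Definition cyl s : set (L -> bool) := [set f | forall x b, s x = Some b -> f x = b].

Definition Fn : set (L -> option bool) := [set s | card_lt (pdom s) [set: K]].

Definition incompatible s t :=
  ~ exists u, [/\ Fn u, pfun_sub s u & pfun_sub t u].

Definition antichain (R : set (L -> option bool)) :=
  forall s t, R s -> R t -> s <> t -> incompatible s t.

Definition pfun_dense (S : set (L -> option bool)) :=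
  forall f, exists2 s, S s & cyl s f.

Definition pfun_le (S R : set (L -> option bool)) :=
  forall r, R r -> exists2 s, S s & pfun_sub s r.

Definition cbase : set (set (L -> bool)) := [set cyl s | s in Fn].

Definition pjoin s t : L -> option bool :=
  fun x => if s x is Some b then Some b else t x.

Lemma Fn_pjoin s t : infinite_set [set: K] -> Fn s -> Fn t -> Fn (pjoin s t).
Proof.
move=> Kinf Fs Ft; rewrite /Fn /= (_ : pdom _ = pdom s `|` pdom t).
  exact: card_lt_setU.
rewrite predeqE /pdom /pjoin => x /=; case: (s x) => [b|]; split => //.
- by left.
- by right.
- by case.
Qed.

Lemma cyl_pjoin s t f : cyl s f -> cyl t f -> cyl (pjoin s t) f.
Proof.
by move=> sf tf x b; rewrite /pjoin; case: (s x) (sf x) => [c /(_ c erefl) <- []|_ /tf].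
Qed.

Lemma pjoinr s t f : cyl s f -> cyl t f -> pfun_sub t (pjoin s t).
Proof.
move=> sf tf x b tb; rewrite /pjoin; case: (s x) (sf x) => // c /(_ c erefl) <-.
by rewrite (tf _ _ tb).
Qed.

Lemma pjoinl s t : pfun_sub s (pjoin s t).
Proof. by move=> x b; rewrite /pjoin => ->. Qed.

Lemma cyl_sub s t : pfun_sub s t -> cyl t `<=` cyl s.
Proof. by move=> st f tf x b /st /tf. Qed.

Lemma incompatibleP s t : infinite_set [set: K] -> Fn s -> Fn t ->
  incompatible s t <-> exists x b, s x = Some b /\ t x = Some (~~ b).
Proof.
move=> Kinf Fs Ft; split; last first.
  move=> [x [b [sx tx]]] [u [_ /(_ _ _ sx) ux /(_ _ _ tx)]].
  by rewrite ux => -[]; case: b {sx tx ux}.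
move=> inc; apply: contrapT => nex; apply: inc; exists (pjoin s t).
split; [exact: Fn_pjoin|exact: pjoinl|].
move=> x b tx; rewrite /pjoin; case E: (s x) => [c|//]; congr Some.
apply: contrapT => cb; apply: nex; exists x, c; split => //.
by rewrite tx; case: b c cb {E tx} => -[].
Qed.

End PartialFunctions.
Arguments Fn : clear implicits.
Arguments cbase : clear implicits.

(* The proof that [K] is infinite is a parameter of the space because the sets
   [cyl s] form a base only when the members of [Fn K L] are closed under
   compatible unions. *)
Definition boxpow (K : Type) (Kinf : infinite_set [set: K]) (L : Type) : Type :=
  L -> bool.

Section BoxTopology.
Variables (K : Type) (Kinf : infinite_set [set: K]) (L : Type).

Local Lemma cyl_cover :
  \bigcup_(s in Fn K L) (cyl s : set (boxpow Kinf L)) = setT.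
Proof.
rewrite predeqE => f; split => // _; exists (fun=> None) => //.
rewrite /Fn /= (_ : pdom _ = set0); last by rewrite predeqE => x; split => // /(_ erefl).
split; first exact: card_ge0.
apply/negP; rewrite card_eq_sym card_eq0 => /eqP K0; apply: Kinf.
by rewrite K0; exact: finite_set0.
Qed.

Local Lemma cyl_join (s t : L -> option bool) (f : boxpow Kinf L) :
  Fn K L s -> Fn K L t -> cyl s f -> cyl t f ->
  exists u, [/\ Fn K L u, cyl u f & cyl u `<=` cyl s `&` cyl t].
Proof.
move=> Fs Ft sf tf; exists (pjoin s t); split; first exact: Fn_pjoin.
  exact: cyl_pjoin.
by rewrite subsetI; split; apply: cyl_sub; [exact: pjoinl|exact: pjoinr tf].
Qed.

HB.instance Definition _ := Choice.copy (boxpow Kinf L) (L -> bool).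
HB.instance Definition _ :=
  isBaseTopological.Build (boxpow Kinf L) cyl_cover cyl_join.

Lemma boxpow_openE (U : set (boxpow Kinf L)) : open U <->
  forall f, U f -> exists s, [/\ Fn K L s, cyl s f & cyl s `<=` U].
Proof.
split=> [[D DFn <-] f [s Ds sf]|h].
  by exists s; split => //; [exact: DFn|move=> g sg; exists s].
exists [set s | Fn K L s /\ cyl s `<=` U]; first by move=> s [].
rewrite predeqE => f; split=> [[s [_ sU] /sU]//|/h[s [Fs sf sU]]].
by exists s.
Qed.

End BoxTopology.

Definition open_cover (X : topologicalType) (U : set (set X)) :=
  U `<=` open /\ cover U id = setT.

Definition b_ultraparacompact (X : topologicalType) (B : set (set X)) :=
  forall U : set (set X), open_cover U ->
  exists V : set (set X), [/\ V `<=` B, cover V id = setT,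
    (forall v, V v -> exists2 u, U u & v `<=` u) & trivIset V id].
Arguments b_ultraparacompact : clear implicits.

(* Main.v *)
Require Import Defs.
From mathcomp Require Import all_boot.
From mathcomp Require Import boolp classical_sets functions cardinality.
From mathcomp Require Import filter topology_structure.

Local Open Scope classical_set_scope.
Local Open Scope card_scope.

(** The antichain [R] and the partition [V] into basic clopen sets correspond
    through [s |-> cyl s], which reverses inclusion in both directions, hence is
    injective, and turns incompatibility into disjointness.  A dense [S] yields
    the open cover of all [cyl s]; an open cover yields the dense set of all [s]
    for which [cyl s] lies in a member of the cover. *)

Lemma cyl_nonempty (L : Type) (s : L -> option bool) : cyl s !=set0.
Proof. by exists (fun x => odflt false (s x)) => x b /= ->. Qed.

Lemma cyl_subP (L : Type) (s t : L -> option bool) :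
  pfun_sub s t <-> cyl t `<=` cyl s.
Proof.
split=> [|ts x b sx]; first exact: cyl_sub.
(* The test point extends [t] by the default [~~ b]; were [t] undefined at [x], it would take the
   value [~~ b] there and leave [cyl s]. *)
have /ts/(_ x b sx) : cyl t (fun y => odflt (~~ b) (t y)) by move=> y c /= ->.
by case: (t x) => [c /= ->|/=]; last by case: b {sx}.
Qed.

Lemma cyl_inj (L : Type) : injective (@cyl L).
Proof.
move=> s t st; apply/funext => x.
have /cyl_subP sub_st : cyl t `<=` cyl s by rewrite st.
have /cyl_subP sub_ts : cyl s `<=` cyl t by rewrite st.
case sx: (s x) => [b|]; first by rewrite (sub_st _ _ sx).
by case tx: (t x) => [c|//]; rewrite -sx; exact: sub_ts.
Qed.

(** A common point makes [pjoin s t] extend both, and its domain stays small since [K] is infinite;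
    conversely, any total function extending a common extension lies in both cylinders. *)
Lemma incompatible_cyl (K L : Type) (s t : L -> option bool) :
    infinite_set [set: K] -> Fn K L s -> Fn K L t ->
  incompatible K s t <-> ~ (cyl s `&` cyl t !=set0).
Proof.
move=> Kinf Fs Ft; split=> [inc [f [sf tf]]|disj [u [_ su tu]]].
  by apply: inc; exists (pjoin s t); split;
    [exact: Fn_pjoin|exact: pjoinl|exact: pjoinr tf].
by have [f uf] := cyl_nonempty _ u; apply: disj; exists f; split;
  [exact: cyl_sub su _ uf|exact: cyl_sub tu _ uf].
Qed.

Lemma open_cyl (K : Type) (Kinf : infinite_set [set: K]) (L : Type)
    (s : L -> option bool) :
  Fn K L s -> open (cyl s : set (boxpow Kinf L)).
Proof. by move=> Fs; apply/boxpow_openE => f sf; exists s; split. Qed.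

Theorem theorem8p2 (K L : Type) (Kinf : infinite_set [set: K])
    (KL : [set: K] #<= [set: L]) :
  b_ultraparacompact (boxpow Kinf L) (cbase K L) <->
  forall S : set (L -> option bool), S `<=` Fn K L -> pfun_dense S ->
    exists R : set (L -> option bool),
      [/\ R `<=` Fn K L, pfun_le S R, antichain K R & pfun_dense R].
Proof.
split=> [ultra S SFn Sdense|refine U [Uopen Ucov]].
- have [|V [VB Vcov VS Vdisj]] := ultra (@cyl L @` S).
    split; first by move=> _ [s /SFn Fs <-]; exact: open_cyl.
    rewrite predeqE => f; split=> // _.
    by have [s Ss sf] := Sdense f; exists (cyl s) => //; exists s.
  exists [set r | Fn K L r /\ V (cyl r)]; split; first by move=> r [].
  + by move=> r [_ /VS[_ [s Ss <-] rs]]; exists s => //; exact/cyl_subP.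
  + move=> s t [Fs Vs] [Ft Vt] st; apply/incompatible_cyl => // meet.
    (* [trivIset V id] says that members of [V] that meet are equal. *)
    by apply: st; apply: cyl_inj; exact: Vdisj meet.
  (* The member of [V] around [f] is basic, so it is [cyl r] for some [r] in the chosen set. *)
  + move=> f; have [v Vv vf] : cover V id f by rewrite Vcov.
    by have [r Fr rv] := VB _ Vv; exists r; rewrite /= rv.
- have [||R [RFn RU Ranti Rdense]] :=
    refine [set s | Fn K L s /\ exists2 u, U u & cyl s `<=` u].
  + by move=> s [].
  + move=> f; have [u Uu uf] : cover U id f by rewrite Ucov.
    (* Density comes from openness: [u] contains a basic set around [f]. *)
    have /boxpow_openE/(_ f uf)[s [Fs sf su]] := Uopen _ Uu.
    by exists s => //; split=> //; exists u.
  exists (@cyl L @` R); split.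
  + by move=> _ [r Rr <-]; exists r => //; exact: RFn.
  + rewrite predeqE => f; split=> // _.
    by have [r Rr rf] := Rdense f; exists (cyl r) => //; exists r.
  + move=> _ [r Rr <-]; have [s [_ [u Uu su]] sr] := RU _ Rr.
    by exists u => //; apply: subset_trans su; exact: cyl_sub.
  + move=> _ _ [r Rr <-] [t Rt <-] meet; apply: contrapT => rt.
    have rt' : r <> t by move=> e; apply: rt; rewrite e.
    by have /incompatible_cyl := Ranti _ _ Rr Rt rt'; apply => //; exact: RFn.
Qed.
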